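(* Let $\mathbf{A}$ be a normed algebra (real or complex) with a unity $1$, let $G$ be an Abelian group, let $\{c(g)\}_{g \in G}$ be a bounded scalar-valued cosine family, and let $\{C(g)\}_{g \in G}$ be an $\mathbf{A}$-valued cosine family such that $$\sup_{g \in G} \| C(g) - c(g) \| < 1.$$ Then $C(g) = c(g)$ for each $g \in G$.
   Context: A normed algebra is an associative algebra over $\mathbb{R}$ or $\mathbb{C}$ with a submultiplicative norm; completeness is not assumed. A scalar $\lambda$ (an element of the base field of $\mathbf{A}$) is identified with the element $\lambda \cdot 1$ of $\mathbf{A}$; thus $C(g) - c(g)$ means $C(g) - c(g)\cdot 1$, and $C(g)=c(g)$ means $C(g) = c(g)\cdot 1$. The Abelian group $G$ is written additively with neutral element $0$. A family $\{C(g)\}_{g \in G}$ in $\mathbf{A}$ is called a cosine family if (i) $2C(g)C(h) = C(g+h) + C(g-h)$ for all $g,h \in G$, and (ii) $C(0) = 1$. A scalar-valued cosine family is a family of scalars satisfying the same two conditions. A family $\{a_\lambda\}_{\lambda\in\Lambda}$ is bounded if $\sup_{\lambda\in\Lambda} \|a_\lambda\| < \infty$. No topology on $G$ and no continuity of the families is assumed. *)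

(* Defs.v *)
From mathcomp Require Import all_boot all_order all_algebra.
From mathcomp Require Import complex.
From mathcomp Require Import all_classical all_reals all_analysis.

Set Implicit Arguments.
Unset Strict Implicit.
Unset Printing Implicit Defensive.

Import Order.TTheory GRing.Theory Num.Theory.

Local Open Scope ring_scope.

(* The norm is an explicit function because Hierarchy-Builder cannot join
   normedModType with algType: numDomainType, whose norm is multiplicative, is
   already the join of the normed and ring hierarchies.  As everywhere in
   MathComp it takes its values in K; when K = R[i], [0 <= N x] includes that
   N x is real, since the order of R[i] only compares numbers with equal
   imaginary parts.  N 1 = 1 is not required. *)
Record algebra_norm (K : numFieldType) (A : algType K) (N : A -> K) : Prop :=
  AlgebraNorm {
    algebra_norm_ge0 : forall x, 0 <= N x;
    algebra_norm_eq0 : forall x, N x = 0 -> x = 0;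
    algebra_normD : forall x y, N (x + y) <= N x + N y;
    algebra_normZ : forall (k : K) x, N (k *: x) = `|k| * N x;
    algebra_normM : forall x y, N (x * y) <= N x * N y
  }.

Definition cosine_family (G : zmodType) (A : pzRingType) (C : G -> A) : Prop :=
  (forall g h : G, 2 * C g * C h = C (g + h) + C (g - h)) /\ C 0 = 1.

(* Main.v *)
(* Let D := C - c. Average D(ng)^2 = C(ng)^2 - 2 c(ng) C(ng) + c(ng)^2 over n,
   where 2 C(ng)^2 = C(2ng) + 1 and 2 c(ng)^2 = c(2ng) + 1. The sums over n < L
   of C(2ng), of c(2ng) and of D(g) c(ng) C(ng) telescope; if |c(2g) - 1| > sup |D| they remain bounded in L.
   So the mean of D(ng)^2, multiplied by D(g), is asymptotically D(g). Since
   that mean has norm at most (sup |D|)^2 < 1, D(g) = 0.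
   The remaining g are reached by doubling. If |c(2g) - 1| <= sup |D|, then
   |c(4g) - 1| >= 2 |c(2g) - 1|, and D(2g) = 0 implies D(g) = 0 because
   D(2g) = (4 c(g) + 2 D(g)) D(g) with |c(g)| > 1/2. If c(2g) = 1, the same formula
   makes |D(2^j g)| grow at least like 2^j |D(2g)|. *)
Require Import Defs.
From mathcomp Require Import all_boot all_order all_algebra.
From mathcomp Require Import complex.
From mathcomp Require Import all_classical all_reals all_analysis.
From mathcomp Require Import ring lra.
Import Order.TTheory GRing.Theory Num.Theory.
Import numFieldNormedType.Exports.
Local Open Scope complex_scope.
Local Open Scope classical_set_scope.
Local Open Scope ring_scope.

(** * Identities for a single cosine family *)

Section CosineFamily.
Set Implicit Arguments.
Unset Strict Implicit.
Variables (G : zmodType) (A : pzRingType) (f : G -> A).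
Hypothesis f_cos : cosine_family f.

Lemma cosine_familyD g h : 2 * f g * f h = f (g + h) + f (g - h).
Proof. by case: f_cos. Qed.

Lemma cosine_family0 : f 0 = 1.
Proof. by case: f_cos. Qed.

Lemma cosine_familyN g : f (- g) = f g.
Proof.
have := cosine_familyD 0 g.
by rewrite cosine_family0 mulr1 add0r sub0r mulr_natl mulr2n => /addrI.
Qed.

Lemma cosine_familyS g n :
  2 * f g * f (g *+ n.+1) = f (g *+ n.+2) + f (g *+ n).
Proof.
by rewrite cosine_familyD -mulrS -[g - _]opprB [g *+ n.+1]mulrSr addrK
  cosine_familyN.
Qed.

Lemma cosine_family_sqr g : 2 * (f g * f g) = f (g *+ 2) + 1.
Proof. by rewrite mulrA cosine_familyD subrr cosine_family0 mulr2n. Qed.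

(** The factor [2 * (f g - 1)] turns [f] into its second difference along the multiples of [g], so
    the sum telescopes to first differences at its two ends. *)
Lemma cosine_family_sum g L :
  2 * (f g - 1) * (\sum_(i < L) f (g *+ i.+1)) =
  (f (g *+ L.+1) - f (g *+ L)) - (f g - 1).
Proof.
rewrite mulr_sumr -(big_mkord xpredT (fun i => _ * f (g *+ i.+1))).
rewrite (@telescope_sumr_eq _ _ _ (fun n => f (g *+ n.+1) - f (g *+ n))) //.
  by rewrite mulr0n mulr1n cosine_family0.
move=> n _; rewrite mulrBr mulrBl mulr1 cosine_familyS mulr_natl mulr2n.
by rewrite opprD addrACA opprB.
Qed.

End CosineFamily.

(** Allows the bound on sums of an algebra-valued family to be applied to the scalar family as
    well. *)
Lemma cosine_familyA (G : zmodType) (K : pzRingType) (A : algType K)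
    (c : G -> K) :
  cosine_family c -> cosine_family (fun g => (c g)%:A : A).
Proof.
case=> cD c0; split=> [g h|]; last by rewrite c0 scale1r.
rewrite -mulrA -scalerAl mul1r scalerA mulr_natl -scaler_nat scalerA mulrA cD.
by rewrite scalerDl.
Qed.

(** * Identities relating a scalar family and an algebra-valued one *)

Section TwoCosineFamilies.
Set Implicit Arguments.
Unset Strict Implicit.
Variables (G : zmodType) (K : comNzRingType) (A : algType K).
Variables (c : G -> K) (C : G -> A).
Hypotheses (c_cos : cosine_family c) (C_cos : cosine_family C).

(** A discrete Wronskian telescopes: [c] and [C] satisfy three-term recurrences with coefficients
    [2 * c g] and [2 * C g], and each increment is the difference of the coefficients times the
    product of the two values. *)
Lemma cosine_family2_sum g L :
  2 * (C g - (c g)%:A) * (\sum_(i < L) c (g *+ i.+1) *: C (g *+ i.+1)) =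
  (c (g *+ L) *: C (g *+ L.+1) - c (g *+ L.+1) *: C (g *+ L)) -
  (C g - (c g)%:A).
Proof.
rewrite mulr_sumr.
rewrite -(big_mkord xpredT (fun i => _ * (c (g *+ i.+1) *: C (g *+ i.+1)))).
rewrite (@telescope_sumr_eq _ _ _ (fun n =>
  c (g *+ n) *: C (g *+ n.+1) - c (g *+ n.+1) *: C (g *+ n))) //.
  by rewrite mulr0n mulr1n !cosine_family0 // scale1r.
move=> n _; rewrite -scalerAr mulrBr mulrBl (cosine_familyS C_cos).
rewrite -[2 * _%:A * _]mulrA -scalerAl mul1r mulr_natl -scaler_nat !scalerA.
rewrite scalerBr scalerA [c _ * _]mulrC (cosine_familyS c_cos).
by rewrite scalerDr scalerDl opprD addrACA opprB.
Qed.

Lemma addr_scalar_sqr (d : A) (k : K) :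
  (d + k%:A) * (d + k%:A) = d * d + 2 *: (k *: d) + (k * k)%:A.
Proof.
rewrite mulrDl !mulrDr -!scalerAr -!scalerAl !mulr1 !mul1r.
by rewrite scaler_nat mulr2n !addrA scalerA.
Qed.

Lemma cosine_family_sub_double g :
  C (g *+ 2) - (c (g *+ 2))%:A =
  4 *: (c g *: (C g - (c g)%:A)) +
  2 * ((C g - (c g)%:A) * (C g - (c g)%:A)).
Proof.
set d := C g - _; have CE : C g = d + (c g)%:A by rewrite subrK.
have c2E : c (g *+ 2) = 2 * (c g * c g) - 1.
  by rewrite (cosine_family_sqr c_cos) addrK.
have -> : C (g *+ 2) = 2 * (C g * C g) - 1.
  by rewrite (cosine_family_sqr C_cos) addrK.
rewrite c2E CE addr_scalar_sqr scalerBl scale1r opprB addrA subrK.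
rewrite 2!mulrDr.
rewrite -(scalerA 2 (c g * c g)) !scaler_nat !mulr_natl addrK addrC.
by rewrite -mulrnA.
Qed.

Lemma cosine_family_sub_sqr g :
  2 * ((C g - (c g)%:A) * (C g - (c g)%:A)) =
  (C (g *+ 2) + 1) + ((c (g *+ 2))%:A + 1) - 4 *: (c g *: C g).
Proof.
(* With this term added, the left side is the right side of the doubling formula. *)
apply: (addrI (4 *: (c g *: (C g - (c g)%:A)))).
rewrite -cosine_family_sub_double.
have -> : 4 *: (c g *: (C g - (c g)%:A)) =
    4 *: (c g *: C g) - ((c (g *+ 2))%:A + 1) *+ 2.
  rewrite 2!scalerBr; congr (_ - _).
  rewrite -[X in _ + X](scale1r (1 : A)) -scalerDl -(cosine_family_sqr c_cos).
  by rewrite -scaler_nat !scalerA; congr (_ *: _); ring.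
rewrite [RHS]addrC [RHS]addrA subrK mulr2n opprD [RHS]addrA addrK opprD.
rewrite addrACA.
by rewrite subrr addr0.
Qed.

End TwoCosineFamilies.

(** * Archimedean comparison and real-valued norms *)

(** Ends both the averaging and the growth argument without passing to a limit. *)
Lemma archi_eq0 (R : archiRealFieldType) (x Q : R) :
  0 <= x -> (forall n, n%:R * x <= Q) -> x = 0.
Proof.
move=> x0 xQ; apply/eqP; rewrite eq_le x0 andbT leNgt; apply/negP => xp.
have Q0 : 0 <= Q by have := xQ 0%N; rewrite mul0r.
have := archi_boundP (divr_ge0 Q0 x0).
by rewrite ltr_pdivrMr // ltNge xQ.
Qed.

(* The norm and the modulus are transported to the ordered field R, because K
   need not be totally ordered. *)
Section RealNorm.
Set Implicit Arguments.
Unset Strict Implicit.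
Variables (R : archiRealFieldType) (K : numFieldType).
Variables (iota : {rmorphism R -> K}) (re : K -> R).
Hypothesis iota_le : {mono iota : x y / x <= y}.
Hypothesis reK : forall x, 0 <= x -> iota (re x) = x.
Variables (A : algType K) (N : A -> K).
Hypothesis N_norm : algebra_norm N.

Definition re_mod (k : K) := re `|k|.
Definition re_norm (x : A) := re (N x).
Local Notation mod := re_mod.
Local Notation nrm := re_norm.

Let iota_mod k : iota (mod k) = `|k|.
Proof. exact: reK. Qed.

Let iota_nrm x : iota (nrm x) = N x.
Proof. exact/reK/(algebra_norm_ge0 N_norm). Qed.

Let iota_inj : injective iota.
Proof. exact: fmorph_inj. Qed.

Lemma re_modM k l : mod (k * l) = mod k * mod l.
Proof. by apply: iota_inj; rewrite rmorphM !iota_mod normrM. Qed.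

Lemma re_modD k l : mod (k + l) <= mod k + mod l.
Proof. by rewrite -iota_le rmorphD !iota_mod ler_normD. Qed.

Lemma re_mod_nat n : mod n%:R = n%:R.
Proof. by apply: iota_inj; rewrite iota_mod rmorph_nat normr_nat. Qed.

Lemma re_mod_ge0 k : 0 <= mod k.
Proof. by rewrite -iota_le rmorph0 iota_mod. Qed.

Lemma re_mod_eq0 k : mod k = 0 -> k = 0.
Proof.
move=> /(congr1 iota); rewrite iota_mod rmorph0 => /eqP.
by rewrite normr_eq0 => /eqP.
Qed.

Lemma re_modN k : mod (- k) = mod k.
Proof. by rewrite /re_mod normrN. Qed.

Lemma re_norm_ge0 x : 0 <= nrm x.
Proof. by rewrite -iota_le rmorph0 iota_nrm (algebra_norm_ge0 N_norm). Qed.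

Lemma re_norm_eq0 x : nrm x = 0 -> x = 0.
Proof.
move=> /(congr1 iota); rewrite iota_nrm rmorph0.
exact: (algebra_norm_eq0 N_norm).
Qed.

Lemma re_normD x y : nrm (x + y) <= nrm x + nrm y.
Proof. by rewrite -iota_le rmorphD !iota_nrm (algebra_normD N_norm). Qed.

Lemma re_normZ k x : nrm (k *: x) = mod k * nrm x.
Proof.
by apply: iota_inj; rewrite rmorphM iota_mod !iota_nrm (algebra_normZ N_norm).
Qed.

Lemma re_normM x y : nrm (x * y) <= nrm x * nrm y.
Proof. by rewrite -iota_le rmorphM !iota_nrm (algebra_normM N_norm). Qed.

Lemma re_normN x : nrm (- x) = nrm x.
Proof. by rewrite -scaleN1r re_normZ re_modN (re_mod_nat 1) mul1r. Qed.

Lemma re_normB x y : nrm (x - y) <= nrm x + nrm y.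
Proof. by rewrite -(re_normN y) re_normD. Qed.

Lemma re_norm_natl n x : nrm (n%:R * x) = n%:R * nrm x.
Proof. by rewrite mulr_natl -scaler_nat re_normZ re_mod_nat. Qed.

Lemma re_norm0 : nrm 0 = 0.
Proof. by rewrite -(scale0r 0) re_normZ (re_mod_nat 0) mul0r. Qed.

Lemma re_norm_sum L (F : 'I_L -> A) (b : R) :
  (forall i, nrm (F i) <= b) -> nrm (\sum_i F i) <= L%:R * b.
Proof.
elim: L F => [|L IH] F Fb; first by rewrite big_ord0 re_norm0 mul0r.
rewrite big_ord_recr /= -natr1 mulrDl mul1r.
by apply: le_trans (re_normD _ _) _; rewrite lerD // IH.
Qed.

(** * Bounded sums of a cosine family away from the value one *)

Section FarFromOne.
Variables (G : zmodType) (f : G -> A) (h : G) (k : K) (s B : R).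
Hypothesis f_cos : cosine_family f.
Hypothesis f_le : forall g, nrm (f g) <= B.
Hypothesis fh_le : nrm (f h - k%:A) <= s.

(* Multiplication by f h - 1 is bounded below, because f h is closer to k
   than k is to 1. *)
Lemma cosine_family_sum_le L :
  (mod (k - 1) - s) * nrm (\sum_(i < L) f (h *+ i.+1)) <= 2 * B.
Proof.
set T := \sum_(i < L) _.
have TE : (k - 1) *: T = (f h - 1) * T - (f h - k%:A) * T.
  rewrite -mulrBl opprB [_ + (_ - f h)]addrC addrA subrK mulrBl -scalerAl.
  by rewrite !mul1r scalerBl scale1r.
have V_le : nrm (2 * (f h - 1) * T) <= 4 * B.
  (* Writing 1 as [f 0] lets [B] bound all four terms of the telescoped sum. *)
  rewrite cosine_family_sum // -(cosine_family0 f_cos).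
  apply: le_trans (re_normB _ _) _.
  have := re_normB (f (h *+ L.+1)) (f (h *+ L)).
  have := re_normB (f h) (f 0).
  have := f_le (h *+ L.+1); have := f_le (h *+ L).
  have := f_le h; have := f_le 0; lra.
have := re_normB ((f h - 1) * T) ((f h - k%:A) * T).
rewrite -TE re_normZ.
have := re_normM (f h - k%:A) T.
have := ler_wpM2r (re_norm_ge0 T) fh_le.
move: V_le; rewrite -mulrA re_norm_natl; lra.
Qed.

End FarFromOne.

(** * Coincidence of two close cosine families *)

Section CloseCosineFamilies.
Variables (G : zmodType) (c : G -> K) (C : G -> A) (b s : R).
Hypotheses (c_cos : cosine_family c) (C_cos : cosine_family C).
Hypothesis c_le : forall g, mod (c g) <= b.
Hypothesis D_le : forall g, nrm (C g - (c g)%:A) <= s.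
Hypothesis s_lt1 : s < 1.

Local Notation D g := (C g - (c g)%:A).

Let s_ge0 : 0 <= s.
Proof. exact: le_trans (re_norm_ge0 _) (D_le 0). Qed.

(** One bound serves both families; [nrm 1] enters because the unity may have norm other than 1. *)
Let B := s + b * nrm 1.

Let c_leB g : nrm (c g)%:A <= B.
Proof.
have := ler_wpM2r (re_norm_ge0 1) (c_le g).
by rewrite re_normZ /B; move: s_ge0; lra.
Qed.

Let C_leB g : nrm (C g) <= B.
Proof.
rewrite -[C g](subrK (c g)%:A); apply: le_trans (re_normD _ _) _.
have := ler_wpM2r (re_norm_ge0 1) (c_le g).
by rewrite re_normZ /B; move: (D_le g); lra.
Qed.

Lemma cosine_family_eq_far g : s < mod (c (g *+ 2) - 1) -> C g = (c g)%:A.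
Proof.
move=> far; set dl := mod _ in far; apply: subr0_eq; apply: re_norm_eq0.
set x := nrm _; have x0 : 0 <= x by exact: re_norm_ge0.
have xs : x <= s := D_le g.
have s2_lt1 : 0 < 1 - s ^+ 2 by rewrite subr_gt0 expr_lt1.
suff /eqP : (1 - s ^+ 2) * x = 0.
  by rewrite mulf_eq0 gt_eqF //= => /eqP.
(* The constant is half the total error in the estimate of [(2 * L)%:R * D g] below: [D g * T] and
   [D g * t] give the first term, the Wronskian sum the other two. *)
apply: (@archi_eq0 _ _ (s * (2 * B / (dl - s)) + 2 * (b * B) + s));
  first by rewrite mulr_ge0 // ltW.
move=> L.
pose T := \sum_(i < L) C (g *+ 2 *+ i.+1).
pose t := \sum_(i < L) (c (g *+ 2 *+ i.+1))%:A : A.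
pose S := \sum_(i < L) c (g *+ i.+1) *: C (g *+ i.+1).
pose X := \sum_(i < L) D (g *+ i.+1) * D (g *+ i.+1).
have dl0 : 0 < dl - s by rewrite subr_gt0.
have T_le : nrm T <= 2 * B / (dl - s).
  rewrite ler_pdivlMr // mulrC.
  exact: cosine_family_sum_le C_cos C_leB (D_le _) _.
have t_le : nrm t <= 2 * B / (dl - s).
  rewrite ler_pdivlMr // mulrC.
  (* The scalar family is at distance 0 from itself, so the bound used for [T] applies with the same
     [s]. *)
  have cc_le : nrm ((c (g *+ 2))%:A - (c (g *+ 2))%:A) <= s.
    by rewrite subrr re_norm0.
  exact: (cosine_family_sum_le (f := fun g => (c g)%:A)
            (cosine_familyA A c_cos) c_leB cc_le).
have S_le : nrm (2 * D g * S) <= 2 * (b * B) + s.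
  rewrite cosine_family2_sum //.
  apply: le_trans (re_normB _ _) _; rewrite lerD //.
  apply: le_trans (re_normB _ _) _; rewrite !re_normZ mulr_natl mulr2n.
  by rewrite lerD // ler_pM // ?re_mod_ge0 ?re_norm_ge0.
have X_le : nrm X <= L%:R * (s * s).
  apply: re_norm_sum => i; apply: le_trans (re_normM _ _) _.
  by rewrite ler_pM // re_norm_ge0.
have XE : 2 * X = T + t + (2 * L)%:R - 4 *: S.
  rewrite /X /T /t /S mulr_sumr scaler_sumr -big_split /=.
  rewrite natrM -[in (_ * L%:R)](card_ord L) -sumr_const mulr_sumr.
  rewrite -big_split /= -sumrB; apply: eq_bigr => i _.
  rewrite cosine_family_sub_sqr // -!mulrnA ![(2 * _)%N]mulnC mulr1.
  by rewrite [C _ + 1 + _]addrACA.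
(* This is [XE] multiplied by [D g] and solved for the main term; only the summand with [X] can grow
   with [L]. *)
have DE : (2 * L)%:R * D g =
    2 * (D g * X) - D g * T - D g * t + 2 * (2 * D g * S).
  move: (D g) => d.
  have -> : 2 * (d * X) = d * (2 * X) by rewrite !mulr_natl mulrnAr.
  rewrite XE mulrBr 2!mulrDr [_ * _%:R]mulr_natr [(2 * L)%:R * _]mulr_natl.
  have -> : d * (4 *: S) = 2 * (2 * d * S).
    by rewrite scaler_nat mulrnAr -mulrA !mulr_natl -mulrnA.
  rewrite -(addrA _ (- (d * T))) -opprD [RHS]addrAC subrK.
  by rewrite [RHS]addrC addKr.
have : nrm ((2 * L)%:R * D g) <= 2 * (x * (L%:R * (s * s))) +
   2 * (s * (2 * B / (dl - s))) + 2 * (2 * (b * B) + s).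
  rewrite DE; apply: le_trans (re_normD _ _) _; rewrite re_norm_natl.
  rewrite lerD ?ler_pM2l //.
  apply: le_trans (re_normB _ _) _.
  rewrite [2 * (s * _)]mulr_natl (mulr2n (s * _)) addrA lerD //; last first.
    by apply: le_trans (re_normM _ _) _; rewrite ler_pM ?re_norm_ge0.
  apply: le_trans (re_normB _ _) _; rewrite lerD //; last first.
    by apply: le_trans (re_normM _ _) _; rewrite ler_pM ?re_norm_ge0.
  rewrite re_norm_natl ler_pM2l //; apply: le_trans (re_normM _ _) _.
  by rewrite ler_pM ?re_norm_ge0.
rewrite re_norm_natl natrM -/x; lra.
Qed.

(** The doubling formula becomes [4 c(g) d = - 2 d^2] for [d = D g], so a nonzero [d] has norm at
    least [2 |c(g)| > 1], contrary to [s < 1]. *)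
Lemma cosine_family_eq_double g :
  mod (c (g *+ 2) - 1) <= s -> C (g *+ 2) = (c (g *+ 2))%:A -> C g = (c g)%:A.
Proof.
move=> near C2; apply: subr0_eq; apply: re_norm_eq0.
have := cosine_family_sub_double c_cos C_cos g; rewrite C2 subrr.
move=> /esym/eqP; rewrite addr_eq0 => /eqP /(congr1 nrm).
rewrite re_normN !re_normZ re_norm_natl re_mod_nat.
have := re_normM (D g) (D g).
(* As [2 c(g)^2 = c(2g) + 1], this yields [|c(g)|^2 >= 1 - s / 2 > 1 / 2]. *)
have : 2 <= mod (2 * (c g * c g)) + mod (1 - c (g *+ 2)).
  rewrite -(re_mod_nat 2); apply: le_trans (re_modD _ _).
  rewrite (cosine_family_sqr c_cos) addrC subrKA.
  by rewrite -[1 + 1]/(2%:R) lexx.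
rewrite !re_modM re_mod_nat -(re_modN (1 - _)) opprB => lb le2 eq2.
have := D_le g; have := re_norm_ge0 (D g); have := re_mod_ge0 (c g).
move: (nrm (D g)) (mod (c g)) le2 eq2 lb near s_lt1 s_ge0.
move=> x m; nra.
Qed.

Lemma cosine_family_eq_pow2 j g :
  s < 2 ^+ j * mod (c (g *+ 2) - 1) -> C g = (c g)%:A.
Proof.
elim: j g => [|j IH] g.
  by rewrite expr0 mul1r; exact: cosine_family_eq_far.
move=> far; case: (ltP s (mod (c (g *+ 2) - 1))) => [|near].
  exact: cosine_family_eq_far.
(* The induction hypothesis is used at [g *+ 2]: the distance of [c] from 1 at least doubles there,
   which makes up for the lost factor 2. *)
apply: cosine_family_eq_double => //; apply: IH; apply: lt_le_trans far _.
rewrite exprSr -mulrA ler_wpM2l ?exprn_ge0 //.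
set k := c (g *+ 2).
have -> : c (g *+ 2 *+ 2) - 1 = 2 * ((k - 1) * (k + 1)).
  have /eqP := cosine_family_sqr c_cos (g *+ 2).
  by rewrite -subr_eq => /eqP <-; rewrite -/k; ring.
rewrite !re_modM re_mod_nat ler_pM2l // ler_peMr ?re_mod_ge0 //.
(* Since [k] is within [s < 1] of 1, the factor [k + 1] has modulus at least 1. *)
have : 2 <= mod (k + 1) + mod (k - 1).
  rewrite -(re_mod_nat 2) -(re_modN (k - 1)); apply: le_trans (re_modD _ _).
  have -> : k + 1 - (k - 1) = 2 by ring.
  exact: lexx.
rewrite -/k in near; move: s_lt1; lra.
Qed.

(** The doubling starts at [g *+ 2] because [c g] itself may be -1. *)
Lemma cosine_family_eq_one g : c (g *+ 2) = 1 -> C (g *+ 2) = 1.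
Proof.
move=> c1.
have c1j j : c (g *+ 2 *+ (2 ^ j)) = 1.
  elim: j => [|j IH]; first by rewrite expn0 mulr1n.
  have /eqP := cosine_family_sqr c_cos (g *+ 2 *+ 2 ^ j).
  by rewrite expnSr (mulrnA (g *+ 2)) IH !mulr1 eq_sym -subr_eq addrK => /eqP.
(* Where [c] is 1, doubling sends [d] to [4 d + 2 d^2], of norm at least [4 x - 2 x^2 >= 2 x] for
   [x = nrm d < 1]. *)
have Dj j : 2 ^+ j * nrm (D (g *+ 2)) <= nrm (D (g *+ 2 *+ (2 ^ j))).
  elim: j => [|j IH]; first by rewrite expr0 mul1r expn0 mulr1n.
  apply: (@le_trans _ _ (2 * nrm (D (g *+ 2 *+ 2 ^ j)))).
    by rewrite exprS -mulrA ler_pM2l.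
  rewrite expnSr mulrnA; set h := _ *+ 2 ^ j.
  have E := cosine_family_sub_double c_cos C_cos h.
  have := re_normB (D (h *+ 2)) (2 * (D h * D h)).
  have mh : mod (c h) = 1 by rewrite c1j (re_mod_nat 1).
  rewrite E addrK -E !re_normZ re_mod_nat mh mul1r re_norm_natl.
  have := re_normM (D h) (D h); have := D_le h; have := re_norm_ge0 (D h).
  move: s_lt1; nra.
apply/eqP; rewrite -subr_eq0 -[X in _ - X]scale1r -c1; apply/eqP.
apply: re_norm_eq0; apply: (@archi_eq0 _ _ s) => [|n]; first exact: re_norm_ge0.
apply: le_trans (D_le (g *+ 2 *+ 2 ^ n)); apply: le_trans (Dj n).
by rewrite ler_wpM2r ?re_norm_ge0 // -natrX ler_nat ltnW // ltn_expl.
Qed.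

Lemma cosine_family_eq g : C g = (c g)%:A.
Proof.
have [c1|c1] := eqVneq (c (g *+ 2)) 1.
  apply: cosine_family_eq_double; last first.
    by rewrite cosine_family_eq_one // c1 scale1r.
  by rewrite c1 subrr (re_mod_nat 0).
(* An integer [n] above [s / |c(2g) - 1|] suffices as exponent, since [n <= 2^n]. *)
have := archi_boundP (divr_ge0 s_ge0 (re_mod_ge0 (c (g *+ 2) - 1))).
set n := Num.bound _ => sn; apply: (@cosine_family_eq_pow2 n).
have m0 : 0 < mod (c (g *+ 2) - 1).
  rewrite lt_neqAle re_mod_ge0 andbT eq_sym; apply: contra c1 => /eqP.
  by move=> /re_mod_eq0 /eqP; rewrite subr_eq0.
rewrite -ltr_pdivrMr //; apply: lt_le_trans sn _.
by rewrite -natrX ler_nat ltnW // ltn_expl.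
Qed.

End CloseCosineFamilies.
End RealNorm.

(** * Specialization to the real and complex fields *)

Theorem theorem1 (R : realType) (K : numFieldType)
    (K_real_or_complex : K = R :> numFieldType \/ K = R[i] :> numFieldType)
    (A : algType K) (N : A -> K) (N_norm : algebra_norm N)
    (G : zmodType) (c : G -> K) (C : G -> A)
    (c_bounded : bounded_fun c) (c_cosine : cosine_family c)
    (C_cosine : cosine_family C)
    (sup_lt1 : exists2 s : K,
       supremums (range (fun g : G => N (C g - (c g)%:A))) s & s < 1) :
  forall g : G, C g = (c g)%:A.
Proof.
have [b c_le] : exists b, forall g, `|c g| <= b.
  (* [bounded_fun] provides bounds only strictly above [M], hence [M + 1]. *)
  case: c_bounded => M [_ c_le]; exists (M + 1) => g.
  by apply: c_le => //; rewrite ltrDl.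
case: sup_lt1 => s [s_ub _] s_lt1.
have {}s_ub g : N (C g - (c g)%:A) <= s by apply: s_ub; exists g.
case: K_real_or_complex => EK; subst K => g.
  (* Over the reals both transport maps are identities; over the complex numbers they are the
     embedding of [R] and the real part. *)
  apply: (@cosine_family_eq R R idfun id _ _ A N N_norm G c C b s) => //.
have re_le (x y : R[i]) : x <= y -> complex.Re x <= complex.Re y.
  by rewrite lecE => /andP[].
have iota_le : {mono real_complex R : x y / x <= y} by move=> x y; exact: lecR.
have reK (x : R[i]) : 0 <= x -> (complex.Re x)%:C = x.
  by move/ger0_real/RRe_real.
have c_le' h : re_mod (@complex.Re R) (c h) <= complex.Re b by exact: re_le.
have D_le h : re_norm (@complex.Re R) N (C h - (c h)%:A) <= complex.Re s.
  exact: re_le.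
have s_lt : complex.Re s < 1 by move: s_lt1; rewrite ltcE => /andP[].
exact: (cosine_family_eq iota_le reK N_norm c_cosine C_cosine c_le' D_le s_lt).
Qed.
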